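(* Suppose that $(m_n)$ and the random matrices $Q_n$ satisfy the Dirichlet hypotheses (1)–(7) listed in the context. Suppose that there exists $N\in\mathbb N$ large enough so that the off-diagonal entries of $Q_n$ satisfy $$(U_n(a)-m_n^2)(L_n(a)-m_n^2)>0,\qquad 0\le a\le n-1,\ n\ge N.$$ Then $-\Delta_n+Q_n$ is diagonalizable with real eigenvalues for every $n\ge N$.
   Context: Notation. $\mathbb R_+=[0,\infty)$, $\mathbb N_0=\{0,1,2,\dots\}$. Entries of $(n+1)\times(n+1)$ matrices are indexed by $0\le a,b\le n$. Let $(m_n)$ be positive numbers. $\Delta_n$ is $m_n^2$ times the $(n+1)\times(n+1)$ tridiagonal matrix with $-2$ on the diagonal and $1$ on the super- and sub-diagonals. $Q_n$ is the $(n+1)\times(n+1)$ tridiagonal matrix with $Q_n(a,a)=D_n(a)$ $(0\le a\le n)$, $Q_n(a,a+1)=U_n(a)$, $Q_n(a+1,a)=L_n(a)$ $(0\le a\le n-1)$, all real random variables. For $E\in\{D,U,L\}$, $E_n(a)=V_n^E(a)+\xi_n^E(a)$ with $V^E_n(a)$ deterministic and $\xi^E_n(a)$ random. Statements for $0\le a\le n$ are understood for $0\le a\le n-1$ when $E=U,L$, and $\xi_n^E(a)=0$ outside the index range. Dirichlet hypotheses: (1) There are $0<C\le1$ and $1/13<\mathfrak d<1/2$ with $Cn^{\mathfrak d}\le m_n\le C^{-1}n^{\mathfrak d}$ for all $n\in\mathbb N$. (2) There are nonnegative continuous $V^D,V^U,V^L:\mathbb R_+\to\mathbb R$ such that $V_n^E(\lfloor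 m_nx\rfloor)\to V^E(x)$ uniformly on compact subsets of $\mathbb R_+$ for each $E$; and $V:=\tfrac12(V^D+V^U+V^L)$ satisfies $V(x)/\log x\to\infty$ as $x\to\infty$. (3) For every $E\in\{D,U,L\}$: for large enough $n$, $0\le V_n^E(a)\le 2m_n^2$ for $0\le a\le n$; and if $C_n=o(n)$ then $\max_{a\le C_n}V_n^E(a)=o(m_n^2)$. (4) At least one $E\in\{D,U,L\}$ satisfies: for every $\theta>0$ there are $c=c(\theta)>0$, $N=N(\theta)\in\mathbb N$ such that for all $n\ge N$, $\theta\log(1+a/m_n)-c\le V^E_n(a)\le m_n^2$ for $0\le a\le n$. Moreover at least one $E\in\{D,U,L\}$ (not necessarily the same) satisfies: there are $\alpha$ with $\frac{\mathfrak d}{2(1-\mathfrak d)}<\alpha\le\frac{2\mathfrak d}{1-\mathfrak d}$, $\varepsilon>0$, and constants $\kappa,C>0$ with $\kappa(a/m_n)^\alpha\le V_n^E(a)\le m_n^2$ for $Cn^{1-\varepsilon}\le a\le n$ and $n$ large enough. (5) For every $n$, and for each $E$, the variables $\xi_n^E(a)$ (over all admissible $a$) are independent. (The vectors $\xi_n^D,\xi_n^U,\xi_n^L$ need not be independent of each other.) (6) For every $E$: $|\mathbf E[\xi_n^E(a)]|=o(m_{n-a}^{-1/2})$ as $(n-a)\to\infty$, and there are $C>0$ and $0<\gamma<2/3$ with $\mathbf E[|\xi_n^E(a)|^q]\le m_n^{q/2}C^qq^{\gamma q}$ for every $0\le a\le n$, $q\in\mathbb N$ and $n$ large enough. (7)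 There are Brownian motions $W^D,W^U,W^L$ such that $\big(\frac1{m_n}\sum_{a=0}^{\lfloor m_nx\rfloor}\xi_n^E(a)\big)_{E=D,U,L}\to(W^E(x))_{E=D,U,L}$, $x\ge0$, in joint distribution in the Skorokhod topology; $W:=\tfrac12(W^D+W^U+W^L)$ is a Brownian motion with some variance $\sigma^2>0$; and if $\varphi_1,\dots,\varphi_k$ are continuous and compactly supported and $\varphi_i^{(n)}\to\varphi_i$ uniformly for each $i$, then $\big(\sum_{a\in\mathbb N_0}\varphi_i^{(n)}(a/m_n)\frac{\xi_n^E(a)}{m_n}\big)_{E,\,i}\to\big(\int_{\mathbb R_+}\varphi_i(a)\,dW^E(a)\big)_{E,\,i}$ in joint distribution, jointly also with the preceding convergence. *)

(* Defs.v *)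
From HB Require Import structures.
From mathcomp Require Import all_boot all_order all_algebra.
From mathcomp Require Import all_classical all_reals all_analysis.
From mathcomp Require Export complex.
Set Implicit Arguments.
Unset Strict Implicit.
Unset Printing Implicit Defensive.
Import Order.TTheory GRing.Theory Num.Theory.
Import numFieldNormedType.Exports.
Local Open Scope classical_set_scope.
Local Open Scope ring_scope.

Section Matrices.
Variable R : realType.

Definition tridiag (n : nat) (d u l : nat -> R) : 'M[R]_n.+1 :=
  \matrix_(i, j) if i == j :> nat then d i
                 else if j == i.+1 :> nat then u i
                 else if i == j.+1 :> nat then l j
                 else 0.

Definition Delta (m : nat -> R) (n : nat) : 'M[R]_n.+1 :=
  m n ^+ 2 *: tridiag n (fun=> - 2) (fun=> 1) (fun=> 1).

(* A real matrix is diagonalized, and its spectrum taken, over R[i]. *)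
Definition diagonalizable_real_spectrum (n : nat) (A : 'M[R]_n.+1) : Prop :=
  let AC : 'M[R[i]]_n.+1 := map_mx (real_complex R) A in
  diagonalizable AC /\
  forall lambda : R[i], eigenvalue AC lambda -> lambda \is Num.real.

End Matrices.

Section Probability.
Context {R : realType}.

(* Mutual independence of the family (X i), i in J: the product rule holds for
   every finite subfamily. *)
Definition mutually_independent d (T : measurableType d)
    (P : probability T R) (I : choiceType) (J : {pred I}) (X : I -> T -> R) :
    Prop :=
  forall (s : seq I) (B : I -> set R), uniq s -> {subset s <= J} ->
    (forall i, measurable (B i)) ->
    P (\bigcap_(i in [set` s]) (X i @^-1` B i)) =
    (\prod_(i <- s) P (X i @^-1` B i))%E.

(* Centered normal law of variance v; the library's [normal_prob 0 0] is not
   the point mass at 0, which has to be singled out. *)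
Definition centered_normal (v : R) : set R -> \bar R :=
  if v == 0 then \d_(0 : R) else normal_prob 0 (Num.sqrt v).

(* Brownian motion with variance sigma^2, started at 0 and indexed by t >= 0
   (values at t < 0 are irrelevant); sigma = 0 gives the null process. *)
Definition brownian_motion d (T : measurableType d) (P : probability T R)
    (sigma : R) (W : R -> T -> R) : Prop :=
  [/\ forall t, 0 <= t -> measurable_fun [set: T] (W t),
      forall w, W 0 w = 0,
      forall w, {within `[0, +oo[, continuous (fun t => W t w)},
      forall s t (B : set R), 0 <= s -> s <= t -> measurable B ->
        P ((fun w => W t w - W s w) @^-1` B) =
        centered_normal (sigma ^+ 2 * (t - s)) B
    & forall t : nat -> R, 0 <= t 0%N -> {homo t : i j / (i <= j)%N >-> i <= j} ->
        mutually_independent P predT (fun i w => W (t i.+1) w - W (t i) w)].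

(* I is the integral of phi against W over [0, +oo[: the L^2 limit of
   the Riemann sums of mesh 1/(k+1) over [0, k+1[.  Meant for phi continuous
   with compact support. *)
Definition wiener_integral d (T : measurableType d) (P : probability T R)
    (W : R -> T -> R) (phi : R -> R) (I : T -> R) : Prop :=
  let t (k j : nat) : R := j%:R / k.+1%:R in
  let riemann_sum (k : nat) (w : T) : R :=
    \sum_(j < k.+1 ^ 2) phi (t k j) * (W (t k j.+1) w - W (t k j) w) in
  measurable_fun [set: T] I /\
  ('E_P[fun w => ((I w - riemann_sum k w) ^+ 2)%R] @[k --> \oo] --> 0)%E.

(* Paths on [0, +oo[ are functions R -> R whose values at negative arguments
   are irrelevant. *)
Definition cadlag (f : R -> R) : Prop :=
  (forall x, 0 <= x -> f y @[y --> x^'+] --> f x) /\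
  (forall x, 0 < x -> cvg (f y @[y --> x^'-])).

Definition time_change (lam : R -> R) : Prop :=
  [/\ lam 0 = 0,
      forall s t, 0 <= s -> s < t -> lam s < lam t
    & forall t, 0 <= t -> exists2 s, 0 <= s & lam s = t].

(* Convergence of sequences in the Skorokhod (J1) topology of D([0, +oo[);
   the topology is metrizable, hence determined by it. *)
Definition skorokhod_cvg (f : nat -> R -> R) (g : R -> R) : Prop :=
  exists lam : nat -> R -> R,
    [/\ forall k, time_change (lam k),
        {uniform `[0, +oo[, lam @ \oo --> (id : R -> R)}
      & forall T : R, 0 <= T ->
          {uniform `[0, T], (fun k => f k \o lam k) @ \oo --> g}].

End Probability.

Inductive entry := Diag | Upper | Lower.

(* Continuity, for the product topology, of a real functional on the product
   of D([0, +oo[)^3 and R^(3k); sequential continuity is continuity since the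
   space is metrizable. *)
Definition skorokhod_continuous (R : realType) (k : nat)
    (F : (entry -> R -> R) -> (entry -> 'I_k -> R) -> R) : Prop :=
  forall (f : nat -> entry -> R -> R) (g : entry -> R -> R)
         (x : nat -> entry -> 'I_k -> R) (y : entry -> 'I_k -> R),
    (forall j E, cadlag (f j E)) -> (forall E, cadlag (g E)) ->
    (forall E, skorokhod_cvg (fun j => f j E) (g E)) ->
    (forall E i, x j E i @[j --> \oo] --> y E i) ->
    F (f j) (x j) @[j --> \oo] --> F g y.

(* Index range of the entries: the off-diagonals have length n. *)
Definition admissible (E : entry) (n a : nat) : bool :=
  if E is Diag then (a <= n)%N else (a < n)%N.

Section DirichletHypotheses.
Variable R : realType.
Variables (m : nat -> R) (dd : R).
Variable V : entry -> nat -> nat -> R.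
Variables (d : nat -> measure_display)
          (Omega : forall n, measurableType (d n))
          (P : forall n, probability (Omega n) R).
Variable xi : entry -> forall n, nat -> {RV (P n) >-> R}.

Definition entry_val (E : entry) (n a : nat) (w : Omega n) : R :=
  V E n a + xi E n a w.

Definition Q (n : nat) (w : Omega n) : 'M[R]_n.+1 :=
  tridiag n (fun a => entry_val Diag a w) (fun a => entry_val Upper a w)
            (fun a => entry_val Lower a w).

Definition scale_growth : Prop :=
  [/\ 13^-1 < dd, dd < 2^-1
    & exists C : R, [/\ 0 < C, C <= 1 &
        forall n, (0 < n)%N ->
          C * n%:R `^ dd <= m n /\ m n <= C^-1 * n%:R `^ dd]].

Definition potential_limit : Prop :=
  exists Vlim : entry -> R -> R,
    [/\ forall E, {within `[0, +oo[, continuous (Vlim E)},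
        forall E x, 0 <= x -> 0 <= Vlim E x,
        forall E (K : set R), compact K -> K `<=` `[0, +oo[ ->
          {uniform K, (fun n x => V E n (Num.truncn (m n * x))) @ \oo
                        --> Vlim E}
      & (2^-1 * (Vlim Diag x + Vlim Upper x + Vlim Lower x)) / ln x
          @[x --> +oo] --> +oo].

Definition potential_bounds (E : entry) : Prop :=
  (\forall n \near \oo, forall a, admissible E n a ->
     0 <= V E n a /\ V E n a <= 2 * m n ^+ 2) /\
  forall C : nat -> R^o,
    C =o_\oo (fun n => n%:R : R^o) ->
    ((fun n => \big[Num.max/0]_(a < n.+1 | admissible E n a && (a%:R <= C n))
                 V E n a) : nat -> R^o)
      =o_\oo (fun n => m n ^+ 2 : R^o).

Definition log_lower_bound (E : entry) : Prop :=
  forall theta : R, 0 < theta ->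
    exists (c : R) (N : nat), 0 < c /\
      forall n a, (N <= n)%N -> admissible E n a ->
        theta * ln (1 + a%:R / m n) - c <= V E n a /\ V E n a <= m n ^+ 2.

Definition power_lower_bound (E : entry) : Prop :=
  exists alpha eps kappa C : R,
    [/\ dd / (2 * (1 - dd)) < alpha, alpha <= 2 * dd / (1 - dd),
        0 < eps, 0 < kappa /\ 0 < C
      & \forall n \near \oo, forall a, admissible E n a ->
          C * n%:R `^ (1 - eps) <= a%:R ->
          kappa * (a%:R / m n) `^ alpha <= V E n a /\ V E n a <= m n ^+ 2].

Definition independent_noise (E : entry) : Prop :=
  forall n, (0 < n)%N ->
    mutually_independent (P n) (admissible E n)
      (fun a => xi E n a : Omega n -> R).

Definition noise_moments (E : entry) : Prop :=
  (forall eps : R, 0 < eps -> exists K : nat, forall n a,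
     (0 < n)%N -> admissible E n a -> (K <= n - a)%N ->
     (`| 'E_(P n)[xi E n a] | <= (eps * m (n - a)%N `^ (- 2^-1))%:E)%E) /\
  exists C gamma : R, [/\ 0 < C, 0 < gamma, gamma < 2 / 3 &
    \forall n \near \oo, forall a q, admissible E n a -> (0 < q)%N ->
      ('E_(P n)[fun w => (`| xi E n a w | ^+ q)%R]
         <= (m n `^ (q%:R / 2) * C ^+ q * q%:R `^ (gamma * q%:R))%:E)%E].

Definition partial_sums (n : nat) (w : Omega n) : entry -> R -> R :=
  fun E x => (m n)^-1 * \sum_(0 <= a < (Num.truncn (m n * x)).+1) xi E n a w.

(* The noise vanishes at a > n, so this is the sum over all natural numbers. *)
Definition linear_stats (k : nat) (psi : nat -> 'I_k -> R -> R)
    (n : nat) (w : Omega n) : entry -> 'I_k -> R :=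
  fun E i => \sum_(0 <= a < n.+1) psi n i (a%:R / m n) * (xi E n a w / m n).

(* The approximations psi n i of phi i are required to vanish outside a common
   compact set.  Without this the requirement could not be met: with phi = 0
   and psi n = c_n constant, c_n -> 0 slowly, the sums c_n / m_n * sum_a xi(a)
   do not tend to 0 as the variance of sum_(a <= m_n x) xi(a) / m_n is about
   sigma^2 x for every fixed x. *)
Definition noise_limit : Prop :=
  exists (d' : measure_display) (Omega' : measurableType d')
         (P' : probability Omega' R) (W : entry -> R -> Omega' -> R)
         (sigmaE : entry -> R) (sigma : R),
    [/\ forall E, 0 <= sigmaE E /\ brownian_motion P' (sigmaE E) (W E),
        0 < sigma,
        brownian_motion P' sigma
          (fun t w => 2^-1 * (W Diag t w + W Upper t w + W Lower t w))
      & forall (k : nat) (phi : 'I_k -> R -> R) (psi : nat -> 'I_k -> R -> R)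
               (M : R),
          (forall i, {within `[0, +oo[, continuous (phi i)}) ->
          (forall i x, M < x -> phi i x = 0) ->
          (forall n i x, M < x -> psi n i x = 0) ->
          (forall i, {uniform `[0, +oo[, (fun n => psi n i) @ \oo --> phi i}) ->
          exists I : entry -> 'I_k -> Omega' -> R,
            (forall E i, wiener_integral P' (W E) (phi i) (I E i)) /\
            forall F : (entry -> R -> R) -> (entry -> 'I_k -> R) -> R,
              (exists B : R, forall f x, `|F f x| <= B) ->
              skorokhod_continuous F ->
              ('E_(P n)[fun w => F (partial_sums w) (linear_stats psi w)]
                 @[n --> \oo]
                 --> 'E_P'[fun w => F (fun E t => W E t w)
                                      (fun E i => I E i w)])%E].

Definition dirichlet_hypotheses : Prop :=
  [/\ scale_growth, potential_limit, forall E, potential_bounds E,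
      (exists E, log_lower_bound E) /\ (exists E, power_lower_bound E)
    & [/\ forall E, independent_noise E, forall E, noise_moments E
        & noise_limit]].

End DirichletHypotheses.

(* Main.v *)
Require Import Defs.
From HB Require Import structures.
From mathcomp Require Import all_boot all_order all_algebra.
From mathcomp Require Import all_classical all_reals all_analysis.
Set Implicit Arguments.
Unset Strict Implicit.
Unset Printing Implicit Defensive.
Import Order.TTheory GRing.Theory Num.Theory.
Import numFieldNormedType.Exports.
Local Open Scope classical_set_scope.
Local Open Scope ring_scope.

(** The argument is deterministic, outcome by outcome: a real tridiagonal matrix
    whose products of opposite off-diagonal entries are positive is similar to a
    real symmetric one.
    Write [d], [u], [l] for the diagonal, upper and lower entries of the
    tridiagonal matrix [A = - Delta + Q]; then [u a * l a > 0] by assumption,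
    because the off-diagonal entries of [- Delta] are [- m n ^+ 2].  The positive
    weights [w a = \prod_(k < a) u k / l k] solve the detailed balance equations
    [w a * u a = w a.+1 * l a], so [w i * A i j = w j * A j i] for all [i], [j]
    ([tridiag_real_spectrum]).  Conjugating [A] by the diagonal matrix of the
    square roots of [w] therefore gives a real symmetric matrix
    ([detailed_balance_real_spectrum]), and the spectral theorem for Hermitian
    matrices passes to similar matrices ([similar_hermitian_real_spectrum]). *)

(** By the spectral theorem [S = U^-1 * D * U] with [U] unitary and [D] real
    diagonal. Hence [U * P] diagonalizes [A] with the same [D], and every
    eigenvalue of [A] is an entry of [D]. *)
Lemma similar_hermitian_real_spectrum (C : numClosedFieldType) n
    (P A S : 'M[C]_n) :
    P \in unitmx -> S \is hermsymmx -> P *m A = S *m P ->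
  diagonalizable A /\ forall lambda, eigenvalue A lambda -> lambda \is Num.real.
Proof.
move=> uP hS PA.
have /hermitian_normalmx /orthomx_spectralP eqS := hS.
have uU := spectral_unit S.
have /mxOverP rD := hermitian_spectral_diag_real hS.
set U := spectralmx S in eqS uU.
set D := spectral_diag S in eqS rD.
have uUP : U *m P \in unitmx by rewrite unitmx_mul uU.
have UPA : U *m P *m A = diag_mx D *m (U *m P).
  by rewrite -mulmxA PA {1}eqS !mulmxA mulmxV// mul1mx.
split.
  exists (U *m P) => //; apply/similar_diagPex; exists D.
  exact/(similarP uUP).
move=> lambda /eigenvalueP[v vA v_neq0].
have [y y_neq0 yD] : exists2 y : 'rV_n, y != 0 & y *m diag_mx D = lambda *: y.
  (* The coordinates of [v] in the diagonalizing basis. *)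
  exists (v *m invmx (U *m P)).
    apply/eqP => y0; move: v_neq0; rewrite -(mulmxKV uUP v) y0.
    by rewrite mul0mx eqxx.
  rewrite -[LHS](mulmxK uUP) -[v *m _ *m _ *m _]mulmxA -UPA mulmxA.
  by rewrite mulmxKV// vA -scalemxAl.
have /rV0Pn[j yj_neq0] := y_neq0.
have /rowP/(_ j) := yD; rewrite mul_mx_diag !mxE mulrC.
by move=> /(mulIf yj_neq0) <-; exact: rD.
Qed.

(** The condition says that [A] is self-adjoint for the inner product with
    weights [w]; rescaling the basis by the square roots of the weights turns
    this inner product into the standard one and [A] into a symmetric matrix. *)
Lemma detailed_balance_real_spectrum (R : realType) n (A : 'M[R]_n.+1)
    (w : 'I_n.+1 -> R) :
    (forall i, 0 < w i) -> (forall i j, w i * A i j = w j * A j i) ->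
  diagonalizable_real_spectrum A.
Proof.
move=> w_gt0 wA.
pose r i := Num.sqrt (w i).
have r_neq0 i : r i != 0 by rewrite gt_eqF// sqrtr_gt0.
have rE i : w i = r i * r i by rewrite -expr2 sqr_sqrtr// ltW.
pose S := \matrix_(i, j) (r i * A i j / r j).
pose P := diag_mx (\row_i r i).
have S_sym i j : S i j = S j i.
  rewrite !mxE; apply: (mulfI (r_neq0 i)); apply: (mulIf (r_neq0 j)).
  rewrite [r i * (r j * _ / _)]mulrC divfK// -[LHS]mulrA divfK//.
  by rewrite mulrA -rE wA rE mulrAC.
rewrite /diagonalizable_real_spectrum.
apply: (@similar_hermitian_real_spectrum _ _ (map_mx (real_complex R) P) _
  (map_mx (real_complex R) S)).
- rewrite map_unitmx unitmxE det_diag unitfE.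
  by apply/prodf_neq0 => i _; rewrite mxE.
- apply: realsym_hermsym.
    apply/is_hermitianmxP.
    apply/matrixP => i j; rewrite expr0 scale1r.
    by rewrite [LHS]mxE S_sym [RHS]mxE [RHS]mxE [RHS]mxE.
  by apply/mxOverP => i j; rewrite mxE complex_real.
- rewrite -!map_mxM; congr map_mx; apply/matrixP => i j.
  by rewrite mul_diag_mx mul_mx_diag !mxE divfK.
Qed.

(** A path has no cycles, so the detailed balance equations can be solved edge
    by edge. *)
Lemma tridiag_real_spectrum (R : realType) n (d u l : nat -> R) :
    (forall a, (a < n)%N -> 0 < u a * l a) ->
  diagonalizable_real_spectrum (tridiag n d u l).
Proof.
move=> ul_gt0.
pose w a := \prod_(k < a) (u k / l k).
have l_neq0 a : (a < n)%N -> l a != 0.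
  by move=> /ul_gt0; apply: contraTneq => ->; rewrite mulr0 ltxx.
have w_gt0 a : (a <= n)%N -> 0 < w a.
  move=> le_an; apply: prodr_gt0 => k _.
  have lt_kn : (k < n)%N by apply: leq_trans (ltn_ord k) le_an.
  have -> : u k / l k = u k * l k / l k ^+ 2.
    by rewrite expr2 invfM mulrA mulfK ?l_neq0.
  by rewrite divr_gt0 ?ul_gt0// exprn_even_gt0//= l_neq0.
have balance a : (a < n)%N -> w a * u a = w a.+1 * l a.
  by move=> lt_an; rewrite /w big_ord_recr/= -!mulrA mulVf ?mulr1 ?l_neq0.
apply: (@detailed_balance_real_spectrum _ _ _ (fun i => w i)) => [i|i j].
  by rewrite w_gt0 // -ltnS.
rewrite !mxE [j == i :> nat]eq_sym; case: eqVneq => [->//|_].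
case: (eqVneq (j : nat) i.+1) => [ji|_].
  have lt_in : (i < n)%N by rewrite -ltnS -ji.
  by rewrite ji (ltn_eqF (leqnSn _)) balance.
case: (eqVneq (i : nat) j.+1) => [ij|_]; last by rewrite !mulr0.
have lt_jn : (j < n)%N by rewrite -ltnS -ij.
by rewrite ij balance.
Qed.

Lemma subDelta_tridiag (R : realType) (m : nat -> R) n (d u l : nat -> R) :
  - Delta m n + tridiag n d u l =
  tridiag n (fun a => d a + 2 * m n ^+ 2) (fun a => u a - m n ^+ 2)
            (fun a => l a - m n ^+ 2).
Proof.
apply/matrixP => i j; rewrite !mxE addrC.
case: ifP => _; first by rewrite mulrN opprK mulrC.
case: ifP => _; first by rewrite mulr1.
by case: ifP => _; rewrite ?mulr1// mulr0 subr0.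
Qed.

Theorem proposition3p5 (R : realType) (m : nat -> R) (dd : R)
    (V : entry -> nat -> nat -> R)
    (d : nat -> measure_display) (Omega : forall n, measurableType (d n))
    (P : forall n, probability (Omega n) R)
    (xi : entry -> forall n, nat -> {RV (P n) >-> R})
    (m_gt0 : forall n, (0 < n)%N -> 0 < m n)
    (xi_out : forall E n a, ~~ admissible E n a -> forall w, xi E n a w = 0)
    (hyps : dirichlet_hypotheses m dd V xi)
    (N : nat) (N_gt0 : (0 < N)%N)
    (offdiag : forall n, (N <= n)%N ->
       {ae P n, forall w, forall a, (a < n)%N ->
          0 < (entry_val V xi Upper a w - m n ^+ 2)
              * (entry_val V xi Lower a w - m n ^+ 2)}) :
  forall n, (N <= n)%N ->
    {ae P n, forall w,
       diagonalizable_real_spectrum (- Delta m n + Q V xi w)}.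
Proof.
move=> n Nn; apply: filterS (offdiag n Nn) => w ul_gt0.
rewrite /Q subDelta_tridiag.
exact: tridiag_real_spectrum.
Qed.
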